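(* Let $A$ be a Banach function algebra on a compact Hausdorff space $X$. Then a point $x\in X$ is a separated point (for the hull-kernel topology on $X$) if and only if $x$ is both an R-point and a point of continuity.
   Context: A Banach function algebra on a compact Hausdorff space $X$ is a subalgebra $A$ of $C(X)$ which contains the constants, separates the points of $X$, and is a Banach algebra under some norm ($X$ need not be the whole character space of $A$). For $x\in X$: $M_x=\{f\in A: f(x)=0\}$, and $J_x$ is the ideal of those $f\in A$ vanishing on some neighbourhood of $x$ in $X$ (for the given compact Hausdorff topology). The hull-kernel topology on $X$ has as open sets the sets $\{y\in X: I\not\subseteq M_y\}$ for closed ideals $I$ of $A$ (equivalently, the sets $\{y\in X: f(y)\ne 0\}$, $f\in A$, form a base); it is a $T_1$ topology. A point of a topological space is a separated point if it can be separated by disjoint open sets from every point not in its closure; here this is applied to the hull-kernel topology on $X$. The point $x\in X$ is an R-point if $J_x\not\subseteq M_y$ for all $y\in X$ with $y\neq x$. The point $x\in X$ is a point of continuity if $J_y\not\subseteq M_x$ for all $y\in X$ with $y\ne x$. *)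

(* Defs.v *)
From HB Require Import structures.
From mathcomp Require Import all_boot all_order all_algebra.
From mathcomp Require Import boolp classical_sets functions reals.
From mathcomp Require Import topology normedtype sequences.
From mathcomp Require Import complex ring.

Set Implicit Arguments.
Unset Strict Implicit.
Unset Printing Implicit Defensive.

Import Order.TTheory GRing.Theory Num.Theory.
Import numFieldNormedType.Exports.
Import ComplexField.Normc.

Local Open Scope ring_scope.
Local Open Scope complex_scope.
Local Open Scope classical_set_scope.

(* The algebra operations on [X -> R[i]] are the pointwise ones, and [R[i]^o] is
   [R[i]] with the topology of its modulus [normc].  The norm is part of the
   data; it is a function on all of [X -> R[i]], but only its values on
   the algebra matter.  The normalisation [bfa_norm 1 = 1] is not imposed. *)
Record banach_function_algebra (R : realType) (X : topologicalType) := BFA {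
  bfa_car :> (X -> R[i]) -> Prop;
  bfa_norm : (X -> R[i]) -> R;
  bfa_cont : forall f, bfa_car f -> continuous (f : X -> R[i]^o);
  bfa_cst : forall c : R[i], bfa_car (cst c);
  bfaD : forall f g, bfa_car f -> bfa_car g -> bfa_car (f + g);
  bfaZ : forall (c : R[i]) f, bfa_car f -> bfa_car (c *: f);
  bfaM : forall f g, bfa_car f -> bfa_car g -> bfa_car (f * g);
  bfa_separates : forall x y : X, x <> y -> exists2 f, bfa_car f & f x <> f y;
  bfa_norm_ge0 : forall f, bfa_car f -> 0 <= bfa_norm f;
  bfa_norm0_eq0 : forall f, bfa_car f -> bfa_norm f = 0 -> f = 0;
  bfa_normD : forall f g, bfa_car f -> bfa_car g ->
    bfa_norm (f + g) <= bfa_norm f + bfa_norm g;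
  bfa_normZ : forall (c : R[i]) f, bfa_car f ->
    bfa_norm (c *: f) = normc c * bfa_norm f;
  bfa_normM : forall f g, bfa_car f -> bfa_car g ->
    bfa_norm (f * g) <= bfa_norm f * bfa_norm g;
  bfa_complete : forall u : nat -> X -> R[i], (forall n, bfa_car (u n)) ->
    (forall e : R, 0 < e -> exists N : nat, forall m n : nat,
       (N <= m)%N -> (N <= n)%N -> bfa_norm (u m - u n) < e) ->
    exists2 f, bfa_car f & (fun n => bfa_norm (u n - f)) @ \oo --> (0 : R)
}.

Section definitions.
Context {R : realType} {X : topologicalType} (A : banach_function_algebra R X).
Implicit Types (I : set (X -> R[i])) (x y : X).

(* M_x *)
Definition vanishing_at x : set (X -> R[i]) := [set f | A f /\ f x = 0].

(* J_x *)
Definition vanishing_near x : set (X -> R[i]) :=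
  [set f | A f /\ \forall y \near x, f y = 0].

(* Closure under scalars follows from [ideal_mul], as [A] contains constants. *)
Record closed_ideal I : Prop := ClosedIdeal {
  ideal_sub : I `<=` bfa_car A;
  ideal0 : I 0;
  idealD : forall f g, I f -> I g -> I (f + g);
  ideal_mul : forall f g, A f -> I g -> I (f * g);
  ideal_closed : forall f, A f ->
    (forall e : R, 0 < e -> exists2 g, I g & bfa_norm A (f - g) < e) -> I f
}.

Definition hull_kernel_open : set (set X) :=
  [set U | exists2 I, closed_ideal I & U = [set y | ~ I `<=` vanishing_at y]].

Definition R_point x := forall y, y <> x -> ~ vanishing_near x `<=` vanishing_at y.

Definition continuity_point x :=
  forall y, y <> x -> ~ vanishing_near y `<=` vanishing_at x.

End definitions.

Definition separated_point (T : topologicalType) (x : T) :=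
  forall y, ~ closure [set x] y ->
    exists U V : set T, [/\ open U, open V, U x, V y & U `&` V = set0].

Section hull_kernel_topology.
Context {R : realType} {X : topologicalType} (A : banach_function_algebra R X).
Local Notation N := (bfa_norm A).

Let A0 : A 0. Proof. exact: (bfa_cst A 0). Qed.
Let A1 : A 1. Proof. exact: (bfa_cst A 1). Qed.

Let AN f : A f -> A (- f).
Proof. by move=> Af; rewrite -scaleN1r; exact: bfaZ. Qed.

Let AB f g : A f -> A g -> A (f - g).
Proof. by move=> Af Ag; apply: bfaD => //; exact: AN. Qed.

Let norm0 : N 0 = 0.
Proof. by rewrite -(scale0r (0 : X -> R[i])) bfa_normZ// normc0 mul0r. Qed.

Let normB f g : A f -> A g -> N (f - g) = N (g - f).
Proof.
move=> Af Ag; rewrite -(opprB g f) -scaleN1r bfa_normZ; last exact: AB.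
by rewrite normcN normc1 mul1r.
Qed.

(* If [N h < 1] then [1 - h] is invertible in [A], by the geometric series. *)
Lemma bfa_neumann h : A h -> N h < 1 -> exists2 s, A s & (1 - h) * s = 1.
Proof.
move=> Ah h1.
pose s := fix s n : X -> R[i] := if n is m.+1 then 1 + h * s m else 0.
pose p := fix p n : X -> R[i] := if n is m.+1 then h * p m else 1.
have As n : A (s n).
  by elim: n => [|n IH] //=; apply: bfaD => //; exact: bfaM.
have Ap n : A (p n) by elim: n => [|n IH] //=; exact: bfaM.
set r := N h in h1; have r0 : 0 <= r by exact: bfa_norm_ge0.
have N1 : 0 <= N 1 by exact: bfa_norm_ge0.
have pn n : N (p n) <= N 1 * r ^+ n.
  elim: n => [|n IH] /=; first by rewrite expr0 mulr1.
  apply: (le_trans (bfa_normM Ah (Ap n))).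
  by rewrite exprS mulrCA ler_wpM2l.
have [B B0 sB] : exists2 B : R, 0 <= B & forall n, N (s n) <= B.
  exists (N 1 / (1 - r)); first by rewrite divr_ge0// subr_ge0 ltW.
  elim=> [|n IH] /=; first by rewrite norm0 divr_ge0// subr_ge0 ltW.
  have := bfa_normD A1 (bfaM Ah (As n)); move/le_trans; apply.
  have : N (h * s n) <= r * (N 1 / (1 - r)).
    by apply: (le_trans (bfa_normM Ah (As n))); rewrite ler_wpM2l.
  move=> le1; apply: (le_trans (lerD (lexx _) le1)).
  have r1 : 1 - r != 0 by rewrite subr_eq0 gt_eqF.
  rewrite le_eqVlt; apply/orP; left; apply/eqP; field; exact: r1.
have sp m k : s (m + k)%N - s m = p m * s k.
  elim: m => [|m IH]; first by rewrite add0n /= subr0 mul1r.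
  by rewrite addSn /= -mulrA -IH mulrBr opprD addrACA subrr add0r.
have geo : (fun n => (N 1 * B) * r ^+ n) @ \oo --> (0 : R).
  rewrite -[X in _ --> X](mulr0 (N 1 * B)); apply: cvgM; first exact: cvg_cst.
  by apply: cvg_expr; rewrite ger0_norm.
have sle m k : N (s (m + k)%N - s m) <= (N 1 * B) * r ^+ m.
  rewrite sp; apply: (le_trans (bfa_normM (Ap m) (As k))).
  rewrite mulrAC; apply: ler_pM => //; exact: bfa_norm_ge0.
have cau e : 0 < e -> exists M : nat, forall m n : nat,
   (M <= m)%N -> (M <= n)%N -> N (s m - s n) < e.
  move=> e0; have /cvgrPdist_lt/(_ e e0) [M _ HM] := geo.
  have key m n : (M <= m)%N -> (m <= n)%N -> N (s n - s m) < e.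
    move=> Mm mn; rewrite -(subnKC mn); apply: (le_lt_trans (sle _ _)).
    have := HM m Mm; rewrite /= sub0r normrN; apply: le_lt_trans.
    exact: ler_norm.
  exists M => m n Mm Mn; have [mn|/ltnW nm] := leqP m n; last exact: key.
  by rewrite normB//; exact: key.
have [t At ut] := bfa_complete As cau.
exists t => //; apply/eqP; rewrite -subr_eq0; apply/eqP.
have A1h : A (1 - h) by exact: AB.
apply: (@bfa_norm0_eq0 _ _ A); first by apply: AB => //; exact: bfaM.
have s1 n : (1 - h) * s n = 1 - p n.
  elim: n => [|n IH] /=; first by rewrite mulr0 subrr.
  by rewrite mulrDr mulr1 mulrCA IH mulrBr mulr1 addrA subrK.
apply/eqP; rewrite eq_le bfa_norm_ge0 ?andbT; last first.
  by apply: AB => //; exact: bfaM.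
have lim0 : (fun n => N (1 - h) * N (s n - t) + N 1 * r ^+ n) @ \oo --> (0 : R).
  rewrite -[X in _ --> X](addr0 (0 : R)); apply: cvgD.
    by rewrite -[X in _ --> X](mulr0 (N (1 - h))); apply: cvgM => //; exact: cvg_cst.
  rewrite -[X in _ --> X](mulr0 (N 1)); apply: cvgM; first exact: cvg_cst.
  by apply: cvg_expr; rewrite ger0_norm.
rewrite -(cvg_lim _ lim0)//; apply: limr_ge; first by apply/cvg_ex; exists 0.
apply: nearW => n.
have -> : (1 - h) * t - 1 = - ((1 - h) * (s n - t)) - p n.
  by rewrite mulrBr s1 opprB -addrA -opprD subrK.
apply: (le_trans (bfa_normD _ _)); [|exact: AN|].
  by apply: AN; apply: bfaM => //; exact: AB.
apply: lerD.
  rewrite -scaleN1r bfa_normZ ?normcN ?normc1 ?mul1r.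
    by apply: bfa_normM => //; exact: AB.
  by apply: bfaM => //; exact: AB.
by rewrite -scaleN1r bfa_normZ// normcN normc1 mul1r.
Qed.

Lemma bfa_eval_le f x : A f -> normc (f x) <= N f.
Proof.
move=> Af; rewrite leNgt; apply/negP => Nf.
have fx0 : 0 < normc (f x) by apply: le_lt_trans Nf; exact: bfa_norm_ge0.
have fxn : f x != 0 by apply: contraTneq fx0 => ->; rewrite normc0 ltxx.
have Ah : A ((f x)^-1 *: f) by exact: bfaZ.
have h1 : N ((f x)^-1 *: f) < 1.
  by rewrite bfa_normZ// normcV mulrC ltr_pdivrMr// mul1r.
have [s _ /(congr1 (fun k => k x))] := bfa_neumann Ah h1.
have -> : ((1 - (f x)^-1 *: f) * s) x = (1 - (f x)^-1 * f x) * s x by [].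
rewrite mulVf// subrr mul0r => /esym/eqP.
by rewrite oner_eq0.
Qed.

Lemma closed_ideal_vanishing_at x : closed_ideal A (vanishing_at A x).
Proof.
split.
- by move=> f [].
- by split.
- move=> f g [Af f0] [Ag g0]; split; first exact: bfaD.
  by have -> : (f + g) x = f x + g x by []; rewrite f0 g0 addr0.
- move=> f g Af [Ag g0]; split; first exact: bfaM.
  by have -> : (f * g) x = f x * g x by []; rewrite g0 mulr0.
- move=> f Af cl; split=> //; apply/eq0_normc/eqP.
  have n0 : 0 <= normc (f x) by case: (f x) => a b; exact: sqrtr_ge0.
  rewrite eq_le n0 andbT; apply/ler_addgt0Pl => e e0; rewrite addr0.
  have [g [Ag g0] /ltW fge] := cl e e0.
  apply: le_trans fge; apply: le_trans (bfa_eval_le x (AB Af Ag)).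
  by have -> : (f - g) x = f x - g x by []; rewrite g0 subr0.
Qed.

Lemma hull_kernel_openT : hull_kernel_open A setT.
Proof.
exists (bfa_car A).
  by split=> //; [exact: bfaD|exact: bfaM].
apply/seteqP; split => y //= _ /(_ 1 A1) [_].
by move/eqP; rewrite oner_eq0.
Qed.

Lemma hull_kernel_openI : setI_closed (hull_kernel_open A).
Proof.
move=> _ _ [I cI ->] [J cJ ->]; exists (I `&` J).
  split.
  - by move=> f [/(ideal_sub cI)].
  - by split; [exact: ideal0 cI|exact: ideal0 cJ].
  - by move=> f g [? ?] [? ?]; split; [exact: (idealD cI)|exact: (idealD cJ)].
  - by move=> f g ? [? ?]; split; [exact: (ideal_mul cI)|exact: (ideal_mul cJ)].
  - move=> f Af cl; split.
      by apply: (ideal_closed cI) => // e /cl [g [Ig _]]; exists g.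
    by apply: (ideal_closed cJ) => // e /cl [g [_ Jg]]; exists g.
apply/seteqP; split=> y /=; last first.
  by move=> IJ; split=> H; apply: IJ => f [If Jf]; exact: H.
move=> [/existsNP[f /not_implyP[If nf]] /existsNP[g /not_implyP[Jg ng]]] IJ.
have Af := ideal_sub cI If; have Ag := ideal_sub cJ Jg.
have [|_] := IJ (f * g).
  by split; [rewrite mulrC; exact: (ideal_mul cI)|exact: (ideal_mul cJ)].
have -> : (f * g) y = f y * g y by [].
by move/eqP; rewrite mulf_eq0 => /orP[] /eqP ?; [exact: nf|exact: ng].
Qed.

Lemma hull_kernel_open_bigU (K : Type) (F : K -> set X) :
  (forall k, hull_kernel_open A (F k)) -> hull_kernel_open A (\bigcup_k F k).
Proof.
move=> HF.
pose S := [set I | closed_ideal A I /\ exists k, F k = [set y | ~ I `<=` vanishing_at A y]].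
exists [set f | A f /\ forall L, closed_ideal A L -> (forall I, S I -> I `<=` L) -> L f].
  split.
  - by move=> f [].
  - by split=> // L cL _; exact: ideal0 cL.
  - move=> f g [Af fL] [Ag gL]; split; first exact: bfaD.
    by move=> L cL SL; apply: (idealD cL); [exact: fL|exact: gL].
  - move=> f g Af [Ag gL]; split; first exact: bfaM.
    by move=> L cL SL; apply: (ideal_mul cL) => //; exact: gL.
  - move=> f Af cl; split=> // L cL SL; apply: (ideal_closed cL) => // e /cl.
    by move=> [g [_ gL] ?]; exists g => //; exact: gL.
apply/seteqP; split=> y /=.
  move=> [k _ Fky] sub; have [I cI FkE] := HF k.
  move: Fky; rewrite FkE; apply => f If; apply: sub.
  split; first exact: (ideal_sub cI).
  by move=> L _ SL; apply: (SL I) => //; split => //; exists k.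
apply: contra_notP => ny f [_ fL].
apply: fL; first exact: closed_ideal_vanishing_at.
move=> I [_ [k FkE]]; apply: contrapT => nI.
by apply: ny; exists k => //; rewrite FkE.
Qed.

End hull_kernel_topology.

(* A copy of [X] carrying the hull-kernel topology of [A]. *)
Definition hull_kernel (R : realType) (X : topologicalType)
  (A : banach_function_algebra R X) : Type := X.

HB.instance Definition _ R X (A : banach_function_algebra R X) :=
  Choice.copy (hull_kernel A) X.

HB.instance Definition _ R X (A : banach_function_algebra R X) :=
  isOpenTopological.Build (hull_kernel A) (hull_kernel_openT A)
    (@hull_kernel_openI _ _ A) (@hull_kernel_open_bigU _ _ A).

Lemma hull_kernel_openE R X (A : banach_function_algebra R X) :
  (open : set (set (hull_kernel A))) = hull_kernel_open A.
Proof. by []. Qed.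

(* Main.v *)
Require Import Defs.
From mathcomp Require Import all_boot all_order all_algebra.
From mathcomp Require Import boolp classical_sets functions reals topology.
From mathcomp Require Import normedtype complex.

(* Two points [x], [y] have disjoint hull-kernel neighbourhoods iff there are
   [f, g] in [A] with [f x <> 0], [g y <> 0] and [f * g = 0].  Then [f] vanishes
   near [y] and [g] near [x], whence the direct implication.  Conversely, take
   [g] in [J_x] with [g y <> 0], vanishing on a neighbourhood [U] of [x].  Since
   [x] is a point of continuity, the compact complement of [U] is covered by
   finitely many open sets on each of which some element of [A] not vanishing
   at [x] vanishes; the product [f] of these elements satisfies [f * g = 0]. *)

Local Open Scope classical_set_scope.

Section hull_kernel_separation.
Set Implicit Arguments.
Unset Strict Implicit.
Import GRing.Theory numFieldNormedType.Exports.
Local Open Scope ring_scope.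
Local Open Scope complex_scope.
Context {R : realType} {X : topologicalType} (A : banach_function_algebra R X).

Lemma hull_kernel_open_neq0 (f : X -> R[i]) : A f ->
  open ([set y | f y != 0] : set (hull_kernel A)).
Proof.
move=> Af; rewrite hull_kernel_openE.
(* The witness is the intersection of the [M_z] over the zeros [z] of [f]. It is closed because each
   [M_z] is, it contains [f], and all its members vanish wherever [f] does. *)
exists [set h | A h /\ forall z, f z = 0 -> vanishing_at A z h].
  split.
  - by move=> h [].
  - have A0 : A 0 by exact: (bfa_cst A 0).
    by split=> // z _; exact: ideal0 (closed_ideal_vanishing_at A z).
  - move=> g h [Ag g0] [Ah h0]; split=> [|z fz]; first exact: bfaD.
    by apply: (idealD (closed_ideal_vanishing_at A z)); [exact: g0|exact: h0].
  - move=> g h Ag [Ah h0]; split=> [|z fz]; first exact: bfaM.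
    by apply: (ideal_mul (closed_ideal_vanishing_at A z)) => //; exact: h0.
  - move=> h Ah cl; split=> // z fz.
    apply: (ideal_closed (closed_ideal_vanishing_at A z)) => // e /cl.
    by move=> [g [_ g0] ge]; exists g => //; exact: g0.
apply/seteqP; split=> y /=.
  move=> /eqP fy0 sub; apply: fy0; have [|//] := sub f.
  by split=> // z fz.
by move=> nsub; apply/eqP => fy0; apply: nsub => h [_]; exact.
Qed.

Lemma hull_kernel_open_sub (U : set (hull_kernel A)) (x : X) :
  open U -> U x -> exists2 f, A f /\ f x != 0 & [set y | f y != 0] `<=` U.
Proof.
rewrite hull_kernel_openE => -[I cI ->] /= /existsNP[f /not_implyP[If nf]].
have Af := ideal_sub cI If.
exists f; first by split=> //; apply/eqP => fx0; exact: nf.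
by move=> y /= /eqP fy0 /(_ f If) [_].
Qed.

Lemma hull_kernel_disjointP (x y : X) :
  (exists U V : set (hull_kernel A),
    [/\ open U, open V, U x, V y & U `&` V = set0]) <->
  exists f g, [/\ A f, A g, f x != 0, g y != 0 & f * g = 0].
Proof.
split=> [[U [V [oU oV Ux Vy UV0]]]|[f [g [Af Ag fx gy fg0]]]].
  have [f [Af fx] fU] := hull_kernel_open_sub oU Ux.
  have [g [Ag gy] gV] := hull_kernel_open_sub oV Vy.
  exists f, g; split=> //; apply/funext => z; rewrite -[LHS]/(f z * g z).
  apply/eqP; rewrite mulf_eq0 -[_ || _]negbK negb_or; apply/negP => /andP[fz gz].
  have : (U `&` V) z by split; [exact: fU|exact: gV].
  by rewrite UV0.
exists [set z | f z != 0], [set z | g z != 0].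
split=> //; try exact: hull_kernel_open_neq0.
apply/seteqP; split=> // z [/= fz gz].
have : f z * g z = 0 by rewrite -[LHS]/((f * g) z) fg0.
by move/eqP; rewrite mulf_eq0 (negbTE fz) (negbTE gz).
Qed.

(** Since [f - f x] vanishes at [x] but not at [y], points are hull-kernel closed. Hence a separated
    point must be separated from every other point. *)
Lemma hull_kernel_closure1 (x y : X) :
  closure ([set x] : set (hull_kernel A)) y <-> y = x.
Proof.
split=> [cl|->]; last exact: subset_closure.
apply: contrapT => yx; have [f Af fyx] := bfa_separates A yx.
have Ag : A (f + cst (- f x)) by apply: bfaD => //; exact: bfa_cst.
have [|z [/= ->]] := cl [set z | (f + cst (- f x)) z != 0].
  apply: open_nbhs_nbhs; split; first exact: hull_kernel_open_neq0.
  by rewrite /= -[(f + _) y]/(f y - f x) subr_eq0; exact/eqP.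
by rewrite -[(f + _) x]/(f x - f x) subrr eqxx.
Qed.

Lemma separated_pointP (x : X) :
  separated_point (x : hull_kernel A) <->
  forall y, y <> x -> exists f g, [/\ A f, A g, f x != 0, g y != 0 & f * g = 0].
Proof.
split=> sep y.
  by move=> yx; apply/hull_kernel_disjointP/sep => /hull_kernel_closure1.
move=> ncl; apply/hull_kernel_disjointP/sep => yx.
exact/ncl/hull_kernel_closure1.
Qed.

(** By continuity for the given topology, [g] has no zero near [y], so [f] must vanish there. *)
Lemma vanishing_near_mul_eq0 (f g : X -> R[i]) (y : X) :
  A f -> A g -> g y != 0 -> f * g = 0 -> vanishing_near A y f.
Proof.
move=> Af Ag gy fg0; split=> //.
have cg : continuous (g : X -> R[i]^o) by exact: bfa_cont Ag.
apply: filterS (cvgr_neq0 _ (cg y) gy) => z gz; apply/eqP.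
have : f z * g z = 0 by rewrite -[LHS]/((f * g) z) fg0.
by move/eqP; rewrite mulf_eq0 (negbTE gz) orbF.
Qed.

Lemma continuity_point_bump (x : X) (U : set X) : compact [set: X] ->
  continuity_point A x -> nbhs x U ->
  exists2 f, A f /\ f x != 0 & forall z, ~ U z -> f z = 0.
Proof.
move=> cX contx Ux; apply: contrapT => nf.
(* Otherwise the sets [{z | ~ U z /\ f z <> 0}], for [f] in [A] with [f x <> 0],
   generate a proper filter, which cannot cluster anywhere. *)
pose F := [set S : set X | exists2 f, A f /\ f x != 0 &
  [set z | ~ U z /\ f z != 0] `<=` S].
have A1 : A 1 by exact: (bfa_cst A 1).
have FF : ProperFilter F.
  split.
    move=> [f fx fS]; apply: nf; exists f => // z nUz.
    by apply: contrapT => fz; apply: (fS z); split=> //; exact/eqP.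
  split.
  - by exists 1 => //; split=> //; exact: oner_neq0.
  (* Products of functions correspond to intersections of the generating sets; this replaces the
     product over a finite subcover. *)
  - move=> S T [f [Af fx] fS] [g [Ag gx] gT]; exists (f * g).
      split; first exact: bfaM.
      by rewrite -[(f * g) x]/(f x * g x) mulf_neq0.
    move=> z [nUz]; rewrite -[(f * g) z]/(f z * g z) mulf_eq0 negb_or.
    by move=> /andP[fz gz]; split; [apply: fS|apply: gT].
  - by move=> S T ST [f fx fS]; exists f => //; exact: subset_trans ST.
have [z [_ clz]] := cX F FF filterT.
have [zx|zx] := pselect (z = x).
  have FU : F (~` U).
    by exists 1; [split=> //; exact: oner_neq0|move=> w []].
  by rewrite zx in clz; have [w []] := clz _ _ FU Ux.
have /existsNP[f /not_implyP[[Af f0] fx]] := contx z zx.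
have Ff : F [set w | f w != 0].
  exists f; last by move=> w [].
  by split=> //; apply/eqP => fx0; exact: fx.
by have [w [/= /eqP]] := clz _ _ Ff f0.
Qed.

End hull_kernel_separation.

Theorem proposition2p2 (R : realType) (X : topologicalType)
    (X_compact : compact [set: X]) (X_hausdorff : hausdorff_space X)
    (A : banach_function_algebra R X) (x : X) :
  separated_point (x : hull_kernel A) <-> R_point A x /\ continuity_point A x.
Proof.
split=> [/separated_pointP sep|[Rx contx]].
  split=> y /sep [f [g [Af Ag fx gy fg0]]] sub.
    have [|_ gy0] := sub g; last by rewrite gy0 eqxx in gy.
    by apply: (vanishing_near_mul_eq0 Ag Af fx); rewrite GRing.mulrC.
  have [|_ fx0] := sub f; last by rewrite fx0 eqxx in fx.
  exact: vanishing_near_mul_eq0 fg0.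
apply/separated_pointP => y yx.
have /existsNP[g /not_implyP[[Ag g0] gy]] := Rx y yx.
(* Here [U] is the zero set of [g], a neighbourhood of [x]; so [f] vanishes wherever [g] does
   not. *)
have [f [Af fx] f0] := continuity_point_bump X_compact contx g0.
exists f, g; split=> //; first by apply/eqP => gy0; exact: gy.
apply/funext => z; have [gz|gz] := pselect (g z = 0%R).
  by rewrite -[LHS]/(f z * g z)%R gz GRing.mulr0.
by rewrite -[LHS]/(f z * g z)%R f0 // GRing.mul0r.
Qed.
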